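(* For all positive real numbers $a,b$ and for all real $r\in[0,e]$, $$a^{ra}+b^{rb}\ge a^{rb}+b^{ra}.$$
   Context: Here $e$ denotes the base of the natural logarithm. *)

(* Defs.v *)
From Stdlib Require Export Reals.

(* Main.v *)
(* Let [b < a], [x = r a], [y = r b], [t = ln (x / y) / 2] and [z = sqrt (x y)].  Since
   [ln r <= 1], it suffices that [2 z sinh t (1 - ln z) <= ln sinh (t x) - ln sinh (t y)],
   where [x = z e^t] and [y = z e^-t].  For fixed [z] the difference of the two sides has
   nonnegative lower limit as [t] tends to 0, and it increases with [t]: its derivative
   divided by [z] is
     [(1 + t) e^t coth (t x) - (1 - t) e^-t coth (t y) - 2 cosh t (1 - ln z)].
   Bounding [coth v] below by [alpha + beta / v] and [- ln z] above by a tangent line makes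
   this affine in [1 / z], with coefficients whose signs are one-variable inequalities in
   [t]. *)
Require Import Defs.
From Stdlib Require Import Reals.
From Stdlib Require Import Lra Psatz.
From Coquelicot Require Import Coquelicot.
Open Scope R_scope.

(** * Elementary bounds for [exp], [ln], [sinh] and [cosh] *)

Lemma nonneg_derive_le (f df : R -> R) (a b : R) :
  a <= b ->
  (forall x, a <= x <= b -> is_derive f x (df x)) ->
  (forall x, a <= x <= b -> 0 <= df x) -> f a <= f b.
Proof.
intros [Hab | <-] Hd Hp; [ | lra].
destruct (MVT_cor2 f df a b Hab) as [c [E Hc]].
- intros x Hx; apply is_derive_Reals; auto.
- assert (0 <= df c) by (apply Hp; lra); nra.
Qed.

Lemma sinh_pos (x : R) : 0 < x -> 0 < sinh x.
Proof. intros Hx; rewrite <- sinh_0; apply sinh_lt, Hx. Qed.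

Lemma cosh_pos (x : R) : 0 < cosh x.
Proof.
unfold cosh; generalize (exp_pos x) (exp_pos (- x)); lra.
Qed.

Lemma cosh2_sub_sinh2 (x : R) : cosh x ^ 2 - sinh x ^ 2 = 1.
Proof.
unfold cosh, sinh; pose proof (exp_plus x (- x)) as E.
rewrite Rplus_opp_r, exp_0 in E; nra.
Qed.

Lemma is_derive_sinh (x : R) : is_derive sinh x (cosh x).
Proof. apply is_derive_Reals, derivable_pt_lim_sinh. Qed.

Lemma is_derive_cosh (x : R) : is_derive cosh x (sinh x).
Proof. apply is_derive_Reals, derivable_pt_lim_cosh. Qed.

Lemma sinh_ge_id (x : R) : 0 <= x -> x <= sinh x.
Proof.
intros Hx.
cut (sinh 0 - 0 <= sinh x - x); [rewrite sinh_0; lra | ].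
apply (nonneg_derive_le (fun t => sinh t - t) (fun t => cosh t - 1)); [easy | | ].
- intros t _; unfold sinh, cosh; auto_derive; [easy | lra].
- intros t _; generalize (cosh2_sub_sinh2 t) (cosh_pos t); nra.
Qed.

Lemma sinh_le_mul_cosh (x : R) : 0 <= x -> sinh x <= x * cosh x.
Proof.
intros Hx.
cut (0 * cosh 0 - sinh 0 <= x * cosh x - sinh x); [rewrite sinh_0; lra | ].
apply (nonneg_derive_le (fun t => t * cosh t - sinh t) (fun t => t * sinh t)); [easy | | ].
- intros t _; unfold sinh, cosh; auto_derive; [easy | lra].
- intros t Ht; pose proof (sinh_ge_id t ltac:(lra)); nra.
Qed.

Lemma exp_le_sum2 (x : R) : 0 <= x -> 1 + x + x ^ 2 / 2 <= exp x.
Proof.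
intros Hx.
cut (exp 0 - (1 + 0 + 0 ^ 2 / 2) <= exp x - (1 + x + x ^ 2 / 2)); [rewrite exp_0; lra | ].
apply (nonneg_derive_le (fun t => exp t - (1 + t + t ^ 2 / 2)) (fun t => exp t - (1 + t)));
  [easy | | ].
- intros t _; auto_derive; [easy | lra].
- intros t Ht; generalize (exp_ineq1_le t); lra.
Qed.

(** Integrating [1 - t <= exp (- t)] twice from 0 gives alternating Taylor bounds; [H1] is the
    intermediate one. *)
Lemma exp_opp_ge_sum3 (x : R) :
  0 <= x -> 1 - x + x ^ 2 / 2 - x ^ 3 / 6 <= exp (- x).
Proof.
assert (H1 : forall x, 0 <= x -> exp (- x) <= 1 - x + x ^ 2 / 2).
{ intros y Hy.
  cut (1 - 0 + 0 ^ 2 / 2 - exp (- 0) <= 1 - y + y ^ 2 / 2 - exp (- y));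
    [rewrite Ropp_0, exp_0; lra | ].
  apply (nonneg_derive_le (fun t => 1 - t + t ^ 2 / 2 - exp (- t)) (fun t => exp (- t) - (1 - t)));
    [easy | | ].
  - intros t _; auto_derive; [easy | lra].
  - intros t Ht; generalize (exp_ineq1_le (- t)); lra. }
intros Hx.
cut (exp (- 0) - (1 - 0 + 0 ^ 2 / 2 - 0 ^ 3 / 6)
     <= exp (- x) - (1 - x + x ^ 2 / 2 - x ^ 3 / 6)); [rewrite Ropp_0, exp_0; lra | ].
apply (nonneg_derive_le (fun t => exp (- t) - (1 - t + t ^ 2 / 2 - t ^ 3 / 6))
  (fun t => 1 - t + t ^ 2 / 2 - exp (- t))); [easy | | ].
- intros t _; auto_derive; [easy | lra].
- intros t Ht; generalize (H1 t); lra.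
Qed.

(** [1 + v <= exp v] at [v = ln u - s]. The right side is the tangent of [ln] at [exp s]; [s] is
    left free. *)
Lemma ln_le_tangent (s u : R) : 0 < u -> ln u <= s - 1 + u * exp (- s).
Proof.
intros Hu; pose proof (exp_ineq1_le (ln u + - s)) as H.
rewrite exp_plus, exp_ln in H by easy; lra.
Qed.

(** * Lower bounds and monotonicity for [coth] *)

Definition coth (x : R) : R := cosh x / sinh x.

Lemma coth_ge_1 (x : R) : 0 < x -> 1 <= coth x.
Proof.
intros Hx; unfold coth; apply Rle_div_r; [now apply sinh_pos | ].
unfold cosh, sinh; generalize (exp_pos (- x)); lra.
Qed.

Lemma coth_ge_inv (x : R) : 0 < x -> / x <= coth x.
Proof.
intros Hx; unfold coth; apply Rle_div_r; [now apply sinh_pos | ].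
rewrite Rmult_comm; apply Rle_div_l; [easy | ].
rewrite Rmult_comm; apply sinh_le_mul_cosh; lra.
Qed.

(** The derivative is nonnegative because [t <= sinh t]. This serves to bound [coth] above at the
    smaller of two arguments. *)
Lemma coth_sub_inv_incr (x y : R) :
  0 < x -> x <= y -> coth x - / x <= coth y - / y.
Proof.
intros Hx Hxy.
apply (nonneg_derive_le (fun t => coth t - / t) (fun t => / t ^ 2 - / sinh t ^ 2)); [easy | | ].
- intros t Ht; pose proof (sinh_pos t ltac:(lra)) as Hs.
  pose proof (cosh2_sub_sinh2 t) as E.
  evar_last.
  + apply (is_derive_minus (V := R_NormedModule)).
    * apply is_derive_div; [apply is_derive_cosh | apply is_derive_sinh | lra].
    * apply is_derive_inv; [apply is_derive_id | lra].
  + unfold minus, plus, opp, one; simpl.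
    replace (sinh t * sinh t - cosh t * cosh t) with (- 1) by lra.
    field; lra.
- intros t Ht; pose proof (sinh_ge_id t ltac:(lra)).
  apply -> Rminus_le_0; apply Rinv_le_contravar; nra.
Qed.

(** The bound has the expansion [/ x + x / 3] of [coth] at 0 and its limit 1 at infinity. Clearing
    denominators in terms of [exp (2 * x)] gives [H], whose left side vanishes at 0 and whose right
    side increases since [sinh t <= t * cosh t]. *)
Lemma coth_ge_rational (x : R) : 0 < x -> / x + x / (3 + x) <= coth x.
Proof.
intros Hx.
assert (H : 0 <= exp (2 * x) * (2 * x - 3) + 2 * x ^ 2 + 4 * x + 3).
{ assert (H1 : forall y, 0 <= y -> 0 <= y * cosh y - sinh y)
    by (intros y Hy; generalize (sinh_le_mul_cosh y Hy); lra).
  cut (exp (2 * 0) * (2 * 0 - 3) + 2 * 0 ^ 2 + 4 * 0 + 3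
       <= exp (2 * x) * (2 * x - 3) + 2 * x ^ 2 + 4 * x + 3);
    [rewrite Rmult_0_r, exp_0; lra | ].
  apply (nonneg_derive_le (fun t => exp (2 * t) * (2 * t - 3) + 2 * t ^ 2 + 4 * t + 3)
    (fun t => 8 * exp t * (t * cosh t - sinh t))); [lra | | ].
  - intros t _; auto_derive; [easy | ].
    unfold cosh, sinh; pose proof (exp_plus t (- t)) as E.
    rewrite Rplus_opp_r, exp_0 in E.
    replace (2 * t) with (t + t) by ring; rewrite exp_plus.
    replace (8 * _ * _) with (4 * (t * (exp t * exp t + exp t * exp (- t))
      - (exp t * exp t - exp t * exp (- t)))) by field.
    rewrite <- E; ring.
  - intros t Ht; pose proof (exp_pos t); pose proof (H1 t ltac:(lra)); nra. }
replace (/ x + x / (3 + x)) with ((3 + x + x ^ 2) / (x * (3 + x))) by (field; lra).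
apply Rle_div_l; [nra | ].
unfold coth; rewrite Rmult_comm; unfold Rdiv; rewrite <- Rmult_assoc.
apply Rle_div_r; [now apply sinh_pos | ].
unfold cosh, sinh.
assert (E : exp (2 * x) * exp (- x) = exp x) by (rewrite <- exp_plus; f_equal; ring).
pose proof (exp_pos (- x)) as Hw; rewrite <- E.
pose proof (Rmult_le_pos _ _ (Rlt_le _ _ Hw) H); nra.
Qed.

(* AM-GM form of [coth_ge_rational]: [w >= 2 l - l^2 / w] with [w = x / (3 + x)]. *)
Lemma coth_ge_affine (l x : R) :
  0 < x -> 2 * l - l ^ 2 + (1 - 3 * l ^ 2) / x <= coth x.
Proof.
intros Hx; refine (Rle_trans _ _ _ _ (coth_ge_rational x Hx)).
apply Rminus_le_0.
replace (_ - _) with ((x - l * (3 + x)) ^ 2 / (x * (3 + x))) by (field; lra).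
apply Rdiv_le_0_compat; [apply pow2_ge_0 | nra].
Qed.

(** * Bounds for [tanh] and [cosh] *)

Lemma tanh_le_id (x : R) : 0 <= x -> tanh x <= x.
Proof.
intros Hx; unfold tanh; apply Rle_div_l; [apply cosh_pos | now apply sinh_le_mul_cosh].
Qed.

Lemma tanh_nonneg (x : R) : 0 <= x -> 0 <= tanh x.
Proof.
intros Hx; unfold tanh; generalize (sinh_ge_id x Hx) (cosh_pos x); intros.
apply Rdiv_le_0_compat; lra.
Qed.

Lemma tanh_ge_cubic (x : R) : 0 <= x -> x - x ^ 3 / 3 <= tanh x.
Proof.
intros Hx.
cut (tanh 0 - (0 - 0 ^ 3 / 3) <= tanh x - (x - x ^ 3 / 3)).
{ replace (tanh 0) with 0 by (unfold tanh; rewrite sinh_0; lra); lra. }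
apply (nonneg_derive_le (fun t => tanh t - (t - t ^ 3 / 3))
  (fun t => t ^ 2 - tanh t ^ 2)); [easy | | ].
- intros t _; pose proof (cosh_pos t); pose proof (cosh2_sub_sinh2 t) as E.
  evar_last.
  + apply (is_derive_minus (V := R_NormedModule)).
    * apply is_derive_div; [apply is_derive_sinh | apply is_derive_cosh | lra].
    * auto_derive; [easy | reflexivity].
  + unfold minus, plus, opp, tanh; simpl; field; lra.
- intros t Ht; pose proof (tanh_le_id t ltac:(lra)); pose proof (tanh_nonneg t ltac:(lra)); nra.
Qed.

(** The quotient of the two sides decreases from 1, again by [sinh t <= t * cosh t]. *)
Lemma cosh_le_gauss (x : R) : 0 <= x -> cosh x <= exp (x ^ 2 / 2).
Proof.
intros Hx.
cut (- (cosh 0 * exp (- (0 ^ 2 / 2))) <= - (cosh x * exp (- (x ^ 2 / 2)))).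
{ rewrite cosh_0; replace (- (0 ^ 2 / 2)) with 0 by field; rewrite exp_0.
  rewrite exp_Ropp; intros H; apply Ropp_le_cancel in H.
  rewrite Rmult_1_r in H.
  apply Rle_div_l in H; [lra | apply exp_pos]. }
apply (nonneg_derive_le (fun t => - (cosh t * exp (- (t ^ 2 / 2))))
  (fun t => (t * cosh t - sinh t) * exp (- (t ^ 2 / 2)))); [easy | | ].
- intros t _; unfold cosh, sinh; auto_derive; [easy | ].
  change (t * (t * 1) * / 2) with (t ^ 2 / 2); field.
- intros t Ht; pose proof (sinh_le_mul_cosh t ltac:(lra)).
  pose proof (exp_pos (- (t ^ 2 / 2))); nra.
Qed.

(** * Sign of the derivative in [t] *)

Lemma one_sub_ln_le (s z : R) : 0 < z -> 1 - ln z <= s + / z * exp (- s).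
Proof.
intros Hz; pose proof (ln_le_tangent s (/ z) (Rinv_0_lt_compat _ Hz)) as H.
rewrite ln_Rinv in H by easy; lra.
Qed.

(** Needed for the coefficient of [/ z] when [t <= 1]. Replacing [exp] by its quadratic Taylor bound
    leaves a polynomial inequality. *)
Lemma one_le_chord_product (t : R) : 0 <= t <= 1 ->
  1 <= (1 - t ^ 2 * (2 / 3 - t / 3)) * exp (t ^ 2 * (5 / 6 - 11 * t / 27)).
Proof.
intros Ht.
pose proof (exp_le_sum2 (t ^ 2 * (5 / 6 - 11 * t / 27)) ltac:(nra)) as HX.
refine (Rle_trans _ _ _ _ (Rmult_le_compat_l _ _ _ _ HX)); [ | nra].
apply Rminus_le_0.
match goal with |- 0 <= ?X => replace X with (t ^ 2 * (1 / 6 - 2 * t / 27 - 5 * t ^ 2 / 24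
  + 17 * t ^ 3 / 81 - 829 * t ^ 4 / 2916 + 665 * t ^ 5 / 1944 - 737 * t ^ 6 / 4374
  + 121 * t ^ 7 / 4374)) by field end.
apply Rmult_le_pos; [nra | ].
(* The Bernstein coefficients of the cofactor are positive. *)
assert (Hb : forall i j : nat, 0 <= t ^ i * (1 - t) ^ j)
  by (intros; apply Rmult_le_pos; apply pow_le; lra).
pose proof (Hb 0 7)%nat; pose proof (Hb 1 6)%nat; pose proof (Hb 2 5)%nat;
pose proof (Hb 3 4)%nat; pose proof (Hb 4 3)%nat; pose proof (Hb 5 2)%nat;
pose proof (Hb 6 1)%nat; pose proof (Hb 7 0)%nat; lra.
Qed.

(** Since [1 - t >= 0], the second [coth] needs an upper bound; [coth_sub_inv_incr] supplies one
    from the first. The first then has the nonnegative factor [Q0] and is bounded below by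
    [coth_ge_affine]. [Hs] and [Hk] compare the constant terms and the coefficients of [/ z]. *)
Lemma slope_nonneg_small (t z : R) : 0 < t <= 1 -> 0 < z ->
  2 * cosh t * (1 - ln z)
  <= (1 + t) * exp t * coth (t * z * exp t)
     - (1 - t) * exp (- t) * coth (t * z * exp (- t)).
Proof.
intros Ht Hz.
(* [s] is the product of the bounds [2 t - t ^ 3 / 3] for [tanh t + t] and
   [2 l - l ^ 2] for the constant term of [coth_ge_affine], with [l = t / 3]. *)
pose (s := t ^ 2 * (6 - t ^ 2) * (6 - t) / 27).
pose proof (one_sub_ln_le s z Hz) as Hln.
pose proof (exp_pos t) as Hw; pose proof (exp_pos (- t)) as Hwi.
assert (Ew : exp t * exp (- t) = 1)
  by (rewrite <- exp_plus, Rplus_opp_r; apply exp_0).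
assert (Hwle : exp (- t) <= exp t) by (apply Rlt_le, exp_increasing; lra).
assert (Htz : 0 < t * z) by nra.
assert (E1 : / (t * z * exp t) = / z * exp (- t) / t)
  by (rewrite exp_Ropp; field; lra).
assert (E2 : / (t * z * exp (- t)) = / z * exp t / t)
  by (rewrite exp_Ropp; field; lra).
pose proof (coth_sub_inv_incr (t * z * exp (- t)) (t * z * exp t) ltac:(nra) ltac:(nra)) as HL.
pose proof (coth_ge_affine (t / 3) (t * z * exp t) ltac:(nra)) as HA.
unfold Rdiv in HA at 3; rewrite E1 in HA; rewrite E1, E2 in HL.
set (c1 := coth (t * z * exp t)) in *; set (c2 := coth (t * z * exp (- t))) in *.
assert (Hu : 0 < / z) by now apply Rinv_0_lt_compat.
pose proof (cosh_pos t) as HC.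
(* The first factor on the right is [2 * cosh t * (tanh t + t)], so [cosh t] cancels. *)
assert (Hs : 2 * cosh t * s
  <= ((1 + t) * exp t - (1 - t) * exp (- t)) * (2 * (t / 3) - (t / 3) ^ 2)).
{ replace ((1 + t) * exp t - (1 - t) * exp (- t)) with (2 * (cosh t * (tanh t + t))).
  2:{ unfold tanh; replace (2 * (cosh t * (sinh t / cosh t + t)))
        with (2 * (sinh t + t * cosh t)) by (field; lra).
      unfold sinh, cosh; field. }
  pose proof (tanh_ge_cubic t ltac:(lra)) as HT.
  rewrite <- (Rmult_assoc 2), !(Rmult_assoc (2 * cosh t)).
  apply Rmult_le_compat_l; [lra | ].
  replace s with ((2 * t - t ^ 3 / 3) * (2 * (t / 3) - (t / 3) ^ 2)) by (unfold s; field).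
  apply Rmult_le_compat_r; [nra | lra]. }
(* Both sides are compared with [2 * (1 - t ^ 2 * (2 / 3 - t / 3))]: the left by the Gaussian bound
   on [cosh], the right by the cubic Taylor bound on [exp (- (2 * t))]. *)
assert (Hk : 2 * cosh t * exp (- s)
  <= 2 - t / 3 * (1 + t - (1 - t) * exp (- (2 * t)))).
{ pose proof (exp_opp_ge_sum3 (2 * t) ltac:(lra)) as H3.
  pose proof (one_le_chord_product t ltac:(lra)) as H1.
  (* [5 / 6 - 11 * t / 27] is the chord over [0, 1] of [(s - t ^ 2 / 2) / t ^ 2]. *)
  assert (HE : t ^ 2 / 2 + - s <= - (t ^ 2 * (5 / 6 - 11 * t / 27))).
  { apply Rminus_le_0; unfold s.
    replace (_ - _) with (t ^ 3 * (1 - t) * (5 - t) / 27) by field.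
    apply Rdiv_le_0_compat; [apply Rmult_le_pos; [ | lra] | lra].
    apply Rmult_le_pos; [apply pow_le | ]; lra. }
  assert (HC' : cosh t * exp (- s) <= / exp (t ^ 2 * (5 / 6 - 11 * t / 27))).
  { rewrite <- exp_Ropp; apply Rle_trans with (exp (t ^ 2 / 2 + - s)).
    - rewrite exp_plus; apply Rmult_le_compat_r; [apply Rlt_le, exp_pos | ].
      apply cosh_le_gauss; lra.
    - destruct HE as [HE | ->]; [apply Rlt_le, exp_increasing, HE | lra]. }
  assert (HY : / exp (t ^ 2 * (5 / 6 - 11 * t / 27)) <= 1 - t ^ 2 * (2 / 3 - t / 3)).
  { pose proof (exp_pos (t ^ 2 * (5 / 6 - 11 * t / 27))).
    apply (Rmult_le_reg_r (exp (t ^ 2 * (5 / 6 - 11 * t / 27)))); [easy | ].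
    rewrite Rinv_l; lra. }
  assert (Hm : t / 3 * (1 + t - (1 - t) * exp (- (2 * t))) <= 2 * (t ^ 2 * (2 / 3 - t / 3))).
  { pose proof (Rmult_le_compat_l (t / 3 * (1 - t)) _ _ ltac:(nra) H3).
    assert (0 <= t ^ 3 * (1 - t) * (3 - 2 * t)).
    { apply Rmult_le_pos; [ | lra]; apply Rmult_le_pos; [apply pow_le | ]; lra. }
    lra. }
  lra. }
assert (Hexp : exp (- (2 * t)) = exp (- t) * exp (- t))
  by (rewrite <- exp_plus; f_equal; ring).
rewrite Hexp in Hk.
set (w := exp t) in *; set (wi := exp (- t)) in *; set (u := / z) in *.
assert (Q0 : 0 <= (1 + t) * w - (1 - t) * wi) by nra.
apply Rle_trans with (2 * cosh t * s + u * (2 * cosh t * exp (- s))); [nra | ].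
apply Rle_trans with (((1 + t) * w - (1 - t) * wi) * c1 + (1 - t) * wi * (u * wi / t - u * w / t));
  [ | pose proof (Rmult_le_compat_l ((1 - t) * wi) _ _ ltac:(nra) HL); lra].
apply Rle_trans with (((1 + t) * w - (1 - t) * wi)
  * (2 * (t / 3) - (t / 3) ^ 2 + (1 - 3 * (t / 3) ^ 2) * (u * wi / t))
  + (1 - t) * wi * (u * wi / t - u * w / t));
  [ | now apply Rplus_le_compat_r, Rmult_le_compat_l].
replace (_ + (1 - t) * wi * _) with (((1 + t) * w - (1 - t) * wi) * (2 * (t / 3) - (t / 3) ^ 2)
  + u * (2 * (w * wi) - t / 3 * ((1 + t) * (w * wi) - (1 - t) * (wi * wi)))) by (field; lra).
rewrite Ew; apply Rplus_le_compat; [exact Hs | ].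
apply Rmult_le_compat_l; [lra | ].
rewrite !Rmult_1_r, <- Rmult_assoc in *; lra.
Qed.

(** For [t >= 1] both [coth] terms have nonnegative factors, so lower bounds suffice: the affine one
    at the larger argument, [/ x] at the smaller. The last two hypotheses compare the constant
    terms, divided by [exp t], and the coefficients of [/ z]. *)
Lemma slope_nonneg_of_affine (al be s t z : R) : 1 <= t -> 0 < z ->
  (forall x, 0 < x -> al + be / x <= coth x) ->
  (1 + exp (- (2 * t))) * s <= (1 + t) * al ->
  (1 + exp (- (2 * t))) * exp (t - s) <= ((1 + t) * be + t - 1) / t ->
  2 * cosh t * (1 - ln z)
  <= (1 + t) * exp t * coth (t * z * exp t)
     - (1 - t) * exp (- t) * coth (t * z * exp (- t)).
Proof.
intros Ht Hz Hc Hs Hk.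
pose proof (one_sub_ln_le s z Hz) as Hln.
pose proof (exp_pos t) as Hw; pose proof (exp_pos (- t)) as Hwi.
assert (Htz : 0 < t * z) by nra.
pose proof (Hc (t * z * exp t) ltac:(nra)) as H1.
pose proof (coth_ge_inv (t * z * exp (- t)) ltac:(nra)) as H2.
assert (Hu : 0 < / z) by now apply Rinv_0_lt_compat.
assert (EC : 2 * cosh t = exp t * (1 + exp (- (2 * t)))).
{ replace (- (2 * t)) with (- t + - t) by ring.
  unfold cosh; rewrite exp_plus, exp_Ropp; field; lra. }
assert (Es : exp t * exp (- s) = exp (t - s)) by (rewrite <- exp_plus; f_equal; ring).
pose proof (cosh_pos t) as HC.
apply Rle_trans with (2 * cosh t * s + / z * (2 * cosh t * exp (- s))); [nra | ].
apply Rle_trans with ((1 + t) * exp t * (al + be / (t * z * exp t))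
  + (t - 1) * exp (- t) * / (t * z * exp (- t))).
2:{ assert (0 <= (1 + t) * exp t) by nra.
    assert (0 <= (t - 1) * exp (- t)) by nra. nra. }
replace (_ + (t - 1) * _ * _) with (exp t * ((1 + t) * al) + / z * (((1 + t) * be + t - 1) / t))
  by (field; lra).
rewrite EC; apply Rplus_le_compat; [nra | ].
apply Rmult_le_compat_l; [lra | ].
rewrite (Rmult_comm (exp t)), Rmult_assoc, Es; exact Hk.
Qed.

Lemma slope_nonneg_medium (t z : R) : 1 <= t <= 2 -> 0 < z ->
  2 * cosh t * (1 - ln z)
  <= (1 + t) * exp t * coth (t * z * exp t)
     - (1 - t) * exp (- t) * coth (t * z * exp (- t)).
Proof.
intros Ht Hz.
(* With [s = t - d] and [l = 3 / 8], both comparisons hold on [1, 2] with a small margin at each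
   end. *)
pose (d := 3 * (t - 1) / 13).
assert (He : exp (- (2 * t)) <= 14 / 100 / (1 + 2 * (t - 1) + 2 * (t - 1) ^ 2)).
{ pose proof (exp_le_sum2 (1 / 4) ltac:(lra)) as H4.
  (* Three squarings of [41 / 32 <= exp (1 / 4)]. *)
  assert (H8 : 50 / 7 <= exp 2).
  { replace 2 with (1 / 4 + 1 / 4 + (1 / 4 + 1 / 4) + (1 / 4 + 1 / 4 + (1 / 4 + 1 / 4)))
      by field.
    rewrite !exp_plus; set (y := exp (1 / 4)) in *.
    assert (H2 : 41 / 25 <= y * y) by nra.
    assert (H3 : 2689 / 1000 <= y * y * (y * y)) by nra.
    nra. }
  pose proof (exp_le_sum2 (2 * (t - 1)) ltac:(lra)) as H5.
  rewrite exp_Ropp; replace (2 * t) with (2 + 2 * (t - 1)) by ring; rewrite exp_plus.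
  replace (14 / 100 / _) with (/ (50 / 7 * (1 + 2 * (t - 1) + 2 * (t - 1) ^ 2)))
    by (field; nra).
  apply Rinv_le_contravar; [nra | ].
  apply Rmult_le_compat; nra. }
set (ep := 14 / 100 / (1 + 2 * (t - 1) + 2 * (t - 1) ^ 2)) in He.
assert (Hep : 0 <= ep) by (apply Rdiv_le_0_compat; nra).
assert (Eep : ep * (1 + 2 * (t - 1) + 2 * (t - 1) ^ 2) = 14 / 100)
  by (unfold ep; field; nra).
(* Bernstein products on [1, 2], for the polynomial inequalities left once the denominator of [ep]
   is cleared. *)
assert (Hb : forall i j : nat, 0 <= (t - 1) ^ i * (2 - t) ^ j)
  by (intros; apply Rmult_le_pos; apply pow_le; lra).
apply (slope_nonneg_of_affine (2 * (3 / 8) - (3 / 8) ^ 2) (1 - 3 * (3 / 8) ^ 2) (t - d));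
  [lra | easy | intros x Hx; now apply coth_ge_affine | | ].
- apply Rle_trans with ((1 + ep) * (t - d)).
  + apply Rmult_le_compat_r; unfold d; lra.
  + unfold d; apply (Rmult_le_reg_r (1 + 2 * (t - 1) + 2 * (t - 1) ^ 2)); [nra | ].
    rewrite Rmult_assoc, (Rmult_comm (t - _)), <- Rmult_assoc, Rmult_plus_distr_r, Eep.
    pose proof (Hb 0 3)%nat; pose proof (Hb 1 2)%nat; pose proof (Hb 2 1)%nat;
    pose proof (Hb 3 0)%nat; lra.
- replace (t - (t - d)) with d by ring.
  apply Rle_trans with ((1 + ep) * / (1 - d)).
  (* [exp d <= / (1 - d)], from [1 - d <= exp (- d)]. *)
  + apply Rmult_le_compat; [generalize (exp_pos (- (2 * t))); lra | apply Rlt_le, exp_pos | lra | ].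
    rewrite <- (Ropp_involutive d) at 1; rewrite exp_Ropp.
    apply Rinv_le_contravar; [unfold d; lra | ].
    generalize (exp_ineq1_le (- d)); lra.
  + apply Rle_div_l; [unfold d; lra | ].
    unfold Rdiv; rewrite Rmult_assoc, (Rmult_comm (/ t)), <- Rmult_assoc.
    apply Rle_div_r; [lra | ].
    apply (Rmult_le_reg_r (1 + 2 * (t - 1) + 2 * (t - 1) ^ 2)); [nra | ].
    rewrite Rmult_assoc, (Rmult_comm t), <- Rmult_assoc, Rmult_plus_distr_r, Eep.
    unfold d; pose proof (Hb 0 4)%nat; pose proof (Hb 1 3)%nat; pose proof (Hb 2 2)%nat;
    pose proof (Hb 3 1)%nat; pose proof (Hb 4 0)%nat; lra.
Qed.

(** Here [1 <= coth x] is enough. With [s = t + 4 / 5] the constant terms need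
    [exp (- (2 * t)) * (t + 4 / 5) <= 1 / 5], and the right side for [/ z] is
    [(t - 1) / t >= 1 / 2]. *)
Lemma slope_nonneg_large (t z : R) : 2 <= t -> 0 < z ->
  2 * cosh t * (1 - ln z)
  <= (1 + t) * exp t * coth (t * z * exp t)
     - (1 - t) * exp (- t) * coth (t * z * exp (- t)).
Proof.
intros Ht Hz.
(* Multiplies [5 <= exp t] and [t + 3 <= exp t], both valid for [t >= 2]. *)
assert (Hep : exp (- (2 * t)) <= / (5 * (t + 3))).
{ pose proof (exp_le_sum2 t ltac:(lra)) as H.
  rewrite exp_Ropp; replace (2 * t) with (t + t) by ring; rewrite exp_plus.
  apply Rinv_le_contravar; [lra | apply Rmult_le_compat; nra]. }
pose proof (exp_pos (- (2 * t))).
assert (Hep' : exp (- (2 * t)) * (t + 3) <= 1 / 5).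
{ apply (Rmult_le_compat_r (t + 3)) in Hep; [ | lra].
  replace (/ _ * _) with (1 / 5) in Hep by (field; lra); easy. }
apply (slope_nonneg_of_affine 1 0 (t + 4 / 5)); [lra | easy | | | ].
- intros x Hx; generalize (coth_ge_1 x Hx); lra.
- nra.
- replace (t - (t + 4 / 5)) with (- (4 / 5)) by ring.
  pose proof (exp_le_sum2 (4 / 5) ltac:(lra)).
  assert (exp (- (4 / 5)) <= 25 / 53).
  { rewrite exp_Ropp; replace (25 / 53) with (/ (53 / 25)) by field.
    apply Rinv_le_contravar; lra. }
  apply Rle_trans with (1 / 2).
  + pose proof (exp_pos (- (4 / 5))); nra.
  + apply (Rle_div_r (1 / 2)); lra.
Qed.

Lemma slope_nonneg (t z : R) : 0 < t -> 0 < z ->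
  2 * cosh t * (1 - ln z)
  <= (1 + t) * exp t * coth (t * z * exp t)
     - (1 - t) * exp (- t) * coth (t * z * exp (- t)).
Proof.
intros Ht Hz; destruct (Rle_lt_dec t 1) as [H1 | H1].
- apply slope_nonneg_small; lra.
- destruct (Rle_lt_dec t 2) as [H2 | H2].
  + apply slope_nonneg_medium; lra.
  + apply slope_nonneg_large; lra.
Qed.

(** * Integration of the slope inequality from [t = 0] *)

Lemma sinh_ratio_ge (t z : R) : 0 < t -> 0 < z ->
  2 * z * sinh t * (1 - ln z)
  <= ln (sinh (t * z * exp t)) - ln (sinh (t * z * exp (- t))).
Proof.
intros Ht Hz.
pose (N := fun x => ln (sinh (x * z * exp x)) - ln (sinh (x * z * exp (- x)))
  - 2 * z * sinh x * (1 - ln z)).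
assert (HN : forall x, 0 < x <= t -> N x <= N t).
{ intros x Hx.
  apply (nonneg_derive_le N (fun y => z * ((1 + y) * exp y * coth (y * z * exp y)
     - (1 - y) * exp (- y) * coth (y * z * exp (- y)) - 2 * cosh y * (1 - ln z)))); [lra | | ].
  - intros y Hy; unfold N.
    assert (Hyz : 0 < y * z) by (apply Rmult_lt_0_compat; lra).
    pose proof (sinh_pos (y * z * exp y) (Rmult_lt_0_compat _ _ Hyz (exp_pos _))) as H1.
    pose proof (sinh_pos (y * z * exp (- y)) (Rmult_lt_0_compat _ _ Hyz (exp_pos _))) as H2.
    assert (D : forall g dg, is_derive g y dg -> 0 < sinh (g y) ->
      is_derive (fun u => ln (sinh (g u))) y (dg * coth (g y))).
    { intros g dg Hg Hp; evar_last.
      - apply (is_derive_comp (fun v => ln (sinh v)) g); [ | exact Hg].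
        apply (is_derive_comp ln sinh); [ | apply is_derive_sinh].
        apply is_derive_ln, Hp.
      - unfold scal, coth; simpl; unfold mult; simpl; field; lra. }
    evar_last.
    + apply (is_derive_minus (V := R_NormedModule));
        [apply (is_derive_minus (V := R_NormedModule)) | ].
      * apply (D (fun x => x * z * exp x)); [ | exact H1].
        auto_derive; [easy | reflexivity].
      * apply (D (fun x => x * z * exp (- x))); [ | exact H2].
        auto_derive; [easy | reflexivity].
      * unfold sinh; auto_derive; [easy | reflexivity].
    + unfold minus, plus, opp; simpl; unfold cosh; field.
  - intros y Hy; apply Rmult_le_pos; [lra | ].
    pose proof (slope_nonneg y z ltac:(lra) Hz); lra. }
(* The difference of logarithms is nonnegative, so only the last term of [N] can be negative, and it
   vanishes with [x]. *)
assert (HN0 : forall x, 0 < x -> - (2 * z * sinh x * Rabs (1 - ln z)) <= N x).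
{ intros x Hx; unfold N.
  assert (Hxz : 0 < x * z) by (apply Rmult_lt_0_compat; lra).
  assert (exp (- x) < exp x) by (apply exp_increasing; lra).
  assert (Hs : ln (sinh (x * z * exp (- x))) <= ln (sinh (x * z * exp x))).
  { apply Rlt_le, ln_increasing.
    - apply sinh_pos, Rmult_lt_0_compat; [easy | apply exp_pos].
    - apply sinh_lt, Rmult_lt_compat_l; easy. }
  pose proof (Rle_abs (1 - ln z)); pose proof (sinh_pos x Hx).
  assert (0 <= z * sinh x) by nra. nra. }
apply Rminus_le_0; fold (N t); apply Rnot_lt_le; intros Hneg.
(* [sinh x <= 2 x] near 0, so [N] has a nonnegative limit inferior there. *)
pose (K := 4 * z * Rabs (1 - ln z) + 1).
assert (HK : 0 < K) by (unfold K; pose proof (Rabs_pos (1 - ln z)); nra).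
(* This gives [N x >= - (x * K) >= N t / 2 > N t], against [HN]. The cap 1 ensures [cosh x <= 2]. *)
pose (x := Rmin (Rmin t 1) (- N t / (2 * K))).
assert (Hx0 : 0 < x).
{ unfold x; repeat apply Rmin_glb_lt; try lra. apply Rdiv_lt_0_compat; lra. }
assert (Hxt : x <= t) by (unfold x; eapply Rle_trans; apply Rmin_l).
assert (Hx1 : x <= 1) by (unfold x; eapply Rle_trans; [apply Rmin_l | apply Rmin_r]).
assert (HxN : x * (2 * K) <= - N t).
{ apply Rle_div_r; [lra | apply Rmin_r]. }
assert (Hsinh : sinh x <= 2 * x).
{ pose proof (sinh_le_mul_cosh x ltac:(lra)).
  assert (cosh x <= 2).
  { pose proof (cosh_le_gauss x ltac:(lra)).
    assert (exp (x ^ 2 / 2) * exp (- (x ^ 2 / 2)) = 1)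
      by (rewrite <- exp_plus, Rplus_opp_r; apply exp_0).
    pose proof (exp_ineq1_le (- (x ^ 2 / 2))).
    assert (Hhalf : 1 / 2 <= exp (- (x ^ 2 / 2))) by nra.
    pose proof (Rmult_le_compat_l (exp (x ^ 2 / 2)) _ _ (Rlt_le _ _ (exp_pos _)) Hhalf); lra. }
  nra. }
pose proof (HN x ltac:(lra)); pose proof (HN0 x Hx0).
assert (2 * z * sinh x * Rabs (1 - ln z) <= x * K).
{ unfold K; pose proof (Rabs_pos (1 - ln z)).
  pose proof (Rmult_le_compat_l (z * Rabs (1 - ln z)) _ _ ltac:(nra) Hsinh); lra. }
nra.
Qed.

(** * Return to powers of [a] and [b] *)

Lemma one_sub_exp_sinh (v : R) : 1 - exp (- (2 * v)) = 2 * exp (- v) * sinh v.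
Proof.
unfold sinh; pose proof (exp_plus v (- v)) as E.
rewrite Rplus_opp_r, exp_0 in E.
replace (- (2 * v)) with (- v + - v) by ring; rewrite exp_plus; lra.
Qed.

(* [x = r a], [y = r b], [t = ln (a / b) / 2]; [z] is the geometric mean of [x] and [y]. *)
Lemma power_diff_le (a b r : R) : 0 < b < a -> 0 < r <= exp 1 ->
  Rpower a (r * b) - Rpower b (r * b) <= Rpower a (r * a) - Rpower b (r * a).
Proof.
intros Hb Hr.
pose (t := (ln a - ln b) / 2).
pose (z := exp (ln r + (ln a + ln b) / 2)).
assert (Ht : 0 < t) by (unfold t; pose proof (ln_increasing b a); lra).
assert (Ea : r * a = z * exp t).
{ unfold z, t; rewrite <- exp_plus.
  replace (_ + _) with (ln r + ln a) by field.
  rewrite exp_plus, !exp_ln; lra. }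
assert (Eb : r * b = z * exp (- t)).
{ unfold z, t; rewrite <- exp_plus.
  replace (_ + _) with (ln r + ln b) by field.
  rewrite exp_plus, !exp_ln; lra. }
assert (Hz : 0 < z) by apply exp_pos.
assert (Hlnr : ln r <= 1).
{ rewrite <- (ln_exp 1); destruct Hr as [Hr0 [Hr1 | ->]]; [ | lra].
  apply Rlt_le, ln_increasing; easy. }
assert (Elz : ln z = ln r + ln a - t) by (unfold z, t; rewrite ln_exp; field).
pose proof (sinh_ratio_ge t z Ht Hz) as H.
rewrite !(Rmult_assoc t), <- Ea, <- Eb in H.
assert (Esh : 2 * z * sinh t = r * a - r * b) by (rewrite Ea, Eb; unfold sinh; field).
rewrite Esh, Elz in H.
assert (Elb : ln b = ln a - 2 * t) by (unfold t; field).
(* [ln a - t] is the mean of [ln a] and [ln b]; factoring out the power of the geometric mean leaves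
   a [sinh]. *)
assert (F : forall c, Rpower a c - Rpower b c = exp (c * (ln a - t)) * 2 * sinh (t * c)).
{ intros c; unfold Rpower; rewrite Elb.
  replace (c * (ln a - 2 * t)) with (c * ln a + - (2 * (t * c))) by ring.
  replace (c * (ln a - t)) with (c * ln a + - (t * c)) by ring.
  rewrite !exp_plus; pose proof (one_sub_exp_sinh (t * c)) as E; nra. }
assert (Hx : 0 < t * (r * a)) by (repeat apply Rmult_lt_0_compat; lra).
assert (Hy : 0 < t * (r * b)) by (repeat apply Rmult_lt_0_compat; lra).
assert (L : forall c v, 0 < v -> exp c * 2 * sinh v = 2 * exp (c + ln (sinh v))).
{ intros c v Hv; rewrite exp_plus, exp_ln by now apply sinh_pos. ring. }
rewrite !F, !L by easy.
apply Rmult_le_compat_l; [lra | ].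
assert (r * b < r * a) by nra.
(* By [H], the exponent on the right exceeds that on the left by at least this product; here
   [r <= exp 1] enters. *)
assert (0 <= (r * a - r * b) * (1 - ln r)) by nra.
assert (HE : r * b * (ln a - t) + ln (sinh (t * (r * b)))
  <= r * a * (ln a - t) + ln (sinh (t * (r * a)))) by lra.
destruct HE as [HE | ->]; [apply Rlt_le, exp_increasing, HE | lra].
Qed.

Theorem theorem1p1 (a b r : R) (ha : 0 < a) (hb : 0 < b)
    (hr : 0 <= r <= exp 1) :
  Rpower a (r * a) + Rpower b (r * b) >= Rpower a (r * b) + Rpower b (r * a).
Proof.
destruct hr as [[hr0 | <-] hr1]; [ | rewrite !Rmult_0_l, !Rpower_O by easy; lra].
(* The inequality is symmetric in [a] and [b]. *)
destruct (Rtotal_order a b) as [H | [-> | H]]; [ | lra | ].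
- pose proof (power_diff_le b a r ltac:(lra) ltac:(lra)); lra.
- pose proof (power_diff_le a b r ltac:(lra) ltac:(lra)); lra.
Qed.
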